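(* The only orthogonal polynomials with a generating function of the form $$H(x,z) = u(z) - \log\left(1 - v(z) x\right) = 1 + \sum_{n=1}^\infty \frac{1}{n} P_n(x) z^n, \qquad P_0 = 1,$$ where $$u(z) = 1 + \sum_{n=1}^\infty \frac{1}{n} u_n z^n, \qquad v(z) = \sum_{n=1}^\infty v_n z^n$$ are formal power series (with real coefficients), are the Chebyshev polynomials of the first kind, up to an affine change of variable and normalization. That is: if such $u$, $v$ are given and the resulting sequence $\{P_n : n\ge 0\}$ is an orthogonal polynomial family, then there exist real numbers $s \neq 0$, $t$ and nonzero real constants $\kappa_n$ such that $P_n(x) = \kappa_n T_n(s x + t)$ for all $n \geq 0$; and, conversely, for all real $s\ne 0$ and $t$ there are nonzero real constants $\kappa_n$ such that the polynomials $P_n(x)=\kappa_n T_n(sx+t)$ have a generating function of this form.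
   Context: An orthogonal polynomial family is a sequence $\{P_n : n \ge 0\}$ of real polynomials with $\deg P_n = n$ that are pairwise orthogonal in $L^2(\mu)$ for some positive Borel measure $\mu$ on $\mathbb{R}$ with infinite support and finite moments of all orders. The generating function identity is an identity of formal power series in $z$ with coefficients polynomial in $x$, with $-\log(1 - v(z)x) = \sum_{k=1}^\infty \frac{1}{k} v(z)^k x^k$. $T_n$ denotes the Chebyshev polynomials of the first kind, $T_n(\cos\theta) = \cos(n\theta)$. *)

(* Defs.v *)
From mathcomp Require Import all_boot all_order all_algebra.
From mathcomp Require Import all_classical all_reals all_analysis.
From mathcomp Require Import ring.

Set Implicit Arguments.
Unset Strict Implicit.
Unset Printing Implicit Defensive.

Import Order.TTheory GRing.Theory Num.Theory.
Import numFieldNormedType.Exports.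

Local Open Scope classical_set_scope.
Local Open Scope ring_scope.

(* The series \sum_n a_n z^n over A is its coefficient sequence n |-> a_n. *)
Definition fps (A : Type) := nat -> A.

Definition fps_one (A : nzRingType) : fps A := fun n => (n == 0%N)%:R.

Definition fps_add (A : nzRingType) (f g : fps A) : fps A :=
  fun n => f n + g n.

Definition fps_mul (A : nzRingType) (f g : fps A) : fps A :=
  fun n => \sum_(i < n.+1) f i * g (n - i)%N.

Definition fps_exp (A : nzRingType) (f : fps A) (k : nat) : fps A :=
  iter k (fps_mul f) (fps_one A).

(* a0 + \sum_(n >= 1) a_n z^n; the value a 0 is ignored. *)
Definition zseries (A : Type) (a0 : A) (a : nat -> A) : fps A :=
  fun n => if n is 0 then a0 else a n.

(* - log (1 - w) = \sum_(k >= 1) w^k / k, for w without constant term. Then w^k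
   has no terms of degree < k in z, so only k = 1, ..., n contribute to the
   coefficient of z^n; see fps_exp_small and fps_neglog1mE. *)
Definition fps_neglog1m (R : fieldType) (A : algType R) (w : fps A) : fps A :=
  fun n => \sum_(1 <= k < n.+1) k%:R^-1 *: fps_exp w k n.

Lemma fps_exp_small (A : nzRingType) (w : fps A) (k n : nat) :
  w 0%N = 0 -> (n < k)%N -> fps_exp w k n = 0.
Proof.
move=> w0; elim: k n => [//|k IHk] n ltnk.
rewrite /fps_exp iterS /fps_mul big1 // => -[[|i] ltin] _ /=.
  by rewrite w0 mul0r.
rewrite [X in _ * X]IHk ?mulr0 //.
by move: ltin ltnk; rewrite !ltnS => ltin ltnk;
   rewrite ltn_subLR // addSn ltnS (leq_trans ltnk) ?leq_addl.
Qed.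

Lemma fps_neglog1mE (R : fieldType) (A : algType R) (w : fps A) (n N : nat) :
  w 0%N = 0 -> (n <= N)%N ->
  \sum_(1 <= k < N.+1) k%:R^-1 *: fps_exp w k n = fps_neglog1m w n.
Proof.
move=> w0 leqnN; rewrite /fps_neglog1m (@big_cat_nat _ _ _ n.+1) //=.
rewrite [X in _ + X]big_nat_cond [X in _ + X]big1 ?addr0 // => k.
by rewrite andbT => /andP[ltnk _]; rewrite fps_exp_small ?scaler0.
Qed.

(* H(x, z) = u(z) - log (1 - v(z) x), a series in z over {poly R} in x = 'X,
   with u(z) = 1 + \sum_(n >= 1) (u_n / n) z^n, v(z) = \sum_(n >= 1) v_n z^n. *)
Definition log_genfun (R : fieldType) (u v : nat -> R) : fps {poly R} :=
  fps_add (fun n => (zseries 1 (fun m => m%:R^-1 * u m) n)%:P)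
          (fps_neglog1m (fun n => zseries 0 v n *: 'X)).

Definition has_log_genfun (R : fieldType) (u v : nat -> R)
    (P : nat -> {poly R}) : Prop :=
  P 0%N = 1 /\
  forall n, log_genfun u v n = zseries 1 (fun m => m%:R^-1 *: P m) n.

Definition mu_support (R : realType)
    (mu : {measure set (measurableTypeR R) -> \bar R}) : set R :=
  [set x : R | forall U : set R, open U -> U x -> (0 < mu U)%E].

Definition orthogonal_family (R : realType) (P : nat -> {poly R}) : Prop :=
  (forall n, size (P n) = n.+1) /\
  exists mu : {measure set (measurableTypeR R) -> \bar R},
    [/\ infinite_set (mu_support mu),
        forall n, mu.-integrable setT (fun x : R => (x ^+ n)%:E) &
        forall m n, m != n ->
          (\int[mu]_x ((P m).[x] * (P n).[x])%:E = 0)%E].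

Definition is_chebyshevT (R : realType) (n : nat) (p : {poly R}) : Prop :=
  forall theta : R, p.[cos theta] = cos (n%:R * theta).

(* The polynomial T_n with T_n (cos theta) = cos (n theta) for all theta; the
   default value 0 is never used, by chebyshevTP. *)
Definition chebyshevT (R : realType) (n : nat) : {poly R} :=
  xget 0 [set p | is_chebyshevT n p].

Lemma is_chebyshevT_ex (R : realType) (n : nat) :
  exists p : {poly R}, is_chebyshevT n p.
Proof.
suff [//] : (exists p : {poly R}, is_chebyshevT n p) /\
            (exists p : {poly R}, is_chebyshevT n.+1 p).
elim: n => [|n [[p hp] [q hq]]]; split.
- by exists 1 => t; rewrite hornerC mul0r cos0.
- by exists 'X => t; rewrite hornerX mul1r.
- by exists q.
exists ('X * q *+ 2 - p) => t.
rewrite hornerD hornerN hornerMn hornerM hornerX hp hq.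
have -> : n%:R * t = n.+1%:R * t - t by rewrite -natr1; ring.
have -> : n.+2%:R * t = n.+1%:R * t + t by rewrite -(natr1 n.+1); ring.
rewrite !cosD cosN sinN; ring.
Qed.

Lemma chebyshevTP (R : realType) (n : nat) : is_chebyshevT n (chebyshevT R n).
Proof. exact: (xgetPex 0 (is_chebyshevT_ex R n)). Qed.

Lemma chebyshevT_unique (R : realType) (n : nat) (p : {poly R}) :
  is_chebyshevT n p -> p = chebyshevT R n.
Proof.
move=> hp; apply/eqP; rewrite -subr_eq0; apply/negPn/negP => nz.
pose s := [seq k.+1%:R^-1 : R | k <- iota 0 (size (p - chebyshevT R n))].
have us : uniq s.
  rewrite map_inj_uniq ?iota_uniq // => i j /invr_inj /eqP.
  by rewrite eqr_nat eqSS => /eqP.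
have rs : all (root (p - chebyshevT R n)) s.
  apply/allP => _ /mapP[k _ ->]; apply/rootP.
  rewrite -[_^-1]acosK ?hornerD ?hornerN ?hp ?chebyshevTP ?subrr //.
  rewrite in_itv /= invf_le1 ?ltr0n // ler1n ltn0Sn andbT.
  by rewrite (le_trans (lerN10 R)) ?invr_ge0 ?ler0n.
by have := max_poly_roots nz rs us; rewrite size_map size_iota ltnn.
Qed.

Definition chebyshevT_affine (R : realType) (kappa s t : R) (n : nat) :
    {poly R} :=
  kappa *: (chebyshevT R n \Po (s *: 'X + t%:P)).

(* Main.v *)
From HB Require Import structures.
Require Import Defs.
From mathcomp Require Import all_boot all_order all_algebra.
From mathcomp Require Import all_classical all_reals all_analysis.
From mathcomp Require Import ring.

(** Write P_n for the polynomials of the generating function, so that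
    Q_n = P_n - u_n is n times the coefficient of z^n in - log (1 - v(z) x).
    Applying z d/dz to this logarithm gives Q (1 - v x) = z v' x, that is the
    recursion
      Q_n = x (n v_n + sum_i v_i Q_(n-i)),
    and this recursion characterizes the generating function
    ([has_log_genfunP]).

    The model solution comes from factoring, for L = a x + b,
      1 - L z + g z^2 = (1 - b z + g z^2) (1 - x a z / (1 - b z + g z^2)).
    Minus the logarithm of the left side is the sum of C_n z^n / n, where
    C_0 = 2, C_1 = L and C_(n+2) = L C_(n+1) - g C_n ([lucas_log_rec]). With
    g = r^2 and L = 2 r (s x + t), C_n is 2 r^n T_n(s x + t)
    ([lucas_chebyshevT]); r = 1 is the converse half of the theorem.

    For the direct half ([log_genfun_lucas]), the three parameters a, b, g are
    fitted to v_1, v_2, v_3, and D_n = P_n - C_n is shown to vanish for n >= 1.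
    The polynomials P_n satisfy the recurrence of C_n up to an error:
      L P_(n+1) = P_(n+2) + g P_n + S,  S = L D_(n+1) - D_(n+2) - g D_n.
    If S has degree less than n, orthogonality forces S = 0: S is orthogonal to
    each of the three other terms, hence to itself ([recurrence_defect]).

    Suppose that v agrees with the model below degree m >= 4 and differs from it
    by f at m. Then D_m and D_(m-1) have degree at most 1 and D_(m+1) has degree
    at most 2, and for n = m - 1 the coefficient of x^2 in S is
    a m f - a (m + 1) f = - a f ([log_rec_diff]). Since S has degree at most
    2 < n, it vanishes, and f = 0. So v is the model series, and every D_n is a constant e_n. The same
    argument now yields a e_n = 0 for n >= 3, then g > 0 from positivity of the
    squared norms ([recurrence_pos]), then g e_2 = 0 and g e_1 = 0. *)

Set Implicit Arguments.
Unset Strict Implicit.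
Unset Printing Implicit Defensive.

Import Order.TTheory GRing.Theory Num.Theory.
Import numFieldNormedType.Exports.

Local Open Scope ring_scope.

(** * The recursion behind a logarithmic generating function *)

(** Truncating a power series to a polynomial makes the ring structure and the
    formal derivative of polynomials available for its powers. *)
Lemma fps_exp_coef (A : nzRingType) (w : fps A) (N k n : nat) :
  (n < N)%N -> fps_exp w k n = ((\poly_(i < N) w i) ^+ k)`_n.
Proof.
elim: k n => [|k IHk] n ltnN; first by rewrite expr0 coef1.
rewrite exprS coefM /fps_exp iterS /fps_mul; apply: eq_bigr => i _.
rewrite coef_poly (leq_ltn_trans (leq_ord i) ltnN); congr (_ * _).
by rewrite -IHk // (leq_ltn_trans (leq_subr i n)).
Qed.

(** With ' standing for z d/dz, F = - log (1 - w) has F' = w' / (1 - w), that is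
    F' = w' + w F'; this is its coefficient of z^n. *)
Lemma fps_neglog1m_rec (R : numFieldType) (A : comAlgType R) (w : fps A) n :
  w 0%N = 0 ->
  n%:R *: fps_neglog1m w n =
    w n *+ n + \sum_(i < n.+1) w i * ((n - i)%:R *: fps_neglog1m w (n - i)%N).
Proof.
move=> w0; case: n => [|N].
  by rewrite big_ord_recl big_ord0 w0 mulr0n mul0r !addr0 scale0r.
pose W := \poly_(i < N.+2) w i.
pose F := \sum_(1 <= k < N.+2) (k%:R^-1 *: 1 : A) *: W ^+ k.
have coefF j : (j <= N.+1)%N -> F`_j = fps_neglog1m w j.
  move=> lejN; rewrite -(fps_neglog1mE w0 lejN) coef_sum; apply: eq_bigr => k _.
  by rewrite coefZ -scalerAl mul1r (fps_exp_coef _ _ (N := N.+2)).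
have dF : F^`() = (\sum_(k < N.+1) W ^+ k) * W^`().
  rewrite mulr_suml raddf_sum big_add1 big_mkord; apply: eq_bigr => k _ /=.
  rewrite derivZ deriv_exp /= -scalerMnr scalerMnl scalerMnl -mulr_natr mulVf.
    by rewrite !scale1r mulrC.
  by rewrite pnatr_eq0.
(* F is the truncated logarithm, so that the geometric sum leaves the error
   term W' W^(N+1), which starts beyond the degree read off below. *)
have geom : F^`() = W^`() + W * F^`() - W^`() * W ^+ N.+1.
  rewrite dF; have := subrX1 W N.+1; set S := \sum_(i < _) _ => e.
  have -> : W ^+ N.+1 = 1 + (W - 1) * S by rewrite -e; ring.
  ring.
have small j : (j <= N)%N -> (W ^+ N.+1)`_j = 0.
  by move=> lejN; rewrite -fps_exp_coef ?fps_exp_small // ltnS leqW.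
have := congr1 (fun p : {poly A} => p`_N) geom.
rewrite coefB coefD !coef_deriv coefF // coef_poly ltnSn coefM.
rewrite [X in _ - X]coefMr ?[X in _ - X]big1 ?subr0; last first.
  by move=> j _; rewrite small ?mulr0 ?leq_ord // leq_subr.
rewrite scaler_nat => ->; congr (_ + _).
rewrite [RHS]big_ord_recr /= subnn scale0r mulr0 addr0.
apply: eq_bigr => i _; rewrite coef_deriv coef_poly subSn ?leq_ord //.
by rewrite coefF ?ltnS ?leq_subr // scaler_nat leqW ?leq_ord.
Qed.

(** Q (1 - v x) = z v' x, read at the coefficient of z^n. *)
Definition log_rec (R : numFieldType) (v : nat -> R) (Q : nat -> {poly R}) :=
  forall n, Q n =
    'X * ((v n *+ n)%:P + \sum_(i < n.+1) (v i)%:P * Q (n - i)%N).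

(** Since v has no constant term, the recursion expresses Q_n through v and the
    Q_k with k < n. *)
Lemma log_rec_unique (R : numFieldType) (v : nat -> R) (Q Q' : nat -> {poly R}) :
  v 0%N = 0 -> log_rec v Q -> log_rec v Q' -> Q =1 Q'.
Proof.
move=> v0 hQ hQ'; elim/ltn_ind => n IHn; rewrite hQ hQ'; congr (_ * (_ + _)).
apply: eq_bigr => -[[|i] lti] _ /=; first by rewrite v0 !mul0r.
by rewrite IHn // ltn_subrL /=; case: n lti {IHn}.
Qed.

(** Multiplying the coefficient of z^n by n turns the generating function
    identity into the recursion for P_n - u_n; the two agree because the
    recursion has a unique solution. *)
Lemma has_log_genfunP (R : numFieldType) (u v : nat -> R) (P : nat -> {poly R}) :
  has_log_genfun u v P <->
  P 0%N = 1 /\ log_rec (zseries 0 v) (zseries 0 (fun m => P m - (u m)%:P)).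
Proof.
set V := zseries 0 v; set Q := zseries 0 _.
pose L n := n%:R *: fps_neglog1m (fun n => V n *: 'X : {poly R}) n.
have recL : log_rec V L.
  move=> n; rewrite {1}/L fps_neglog1m_rec ?scale0r // mulrDr; congr (_ + _).
    by rewrite scalerMnl -mul_polyC mulrC.
  rewrite mulr_sumr; apply: eq_bigr => i _.
  by rewrite -/(L _) -mul_polyC mulrCA mulrA.
have eqv n : log_genfun u v n.+1 = n.+1%:R^-1 *: P n.+1 <-> Q n.+1 = L n.+1.
  have n0 : n.+1%:R != 0 :> R by rewrite pnatr_eq0.
  rewrite /log_genfun /fps_add /= /L /= -/V -scale_polyC.
  split=> e.
    apply: (scalerI (invr_neq0 n0)); rewrite scalerBr -e addrC addKr.
    by rewrite scalerA mulVf ?scale1r.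
  rewrite -[P n.+1](subrK (u n.+1)%:P) e scalerDr scalerA mulVf // scale1r.
  exact: addrC.
split=> [[P0 hP]|[P0 hQ]]; split=> //.
  move=> n; have eQL m : Q m = L m.
    by case: m => [|m]; [rewrite /L scale0r|apply/eqv; rewrite hP].
  rewrite eQL recL; congr (_ * (_ + _)); apply: eq_bigr => i _.
  by rewrite eQL.
case=> [|n]; last by apply/eqv/(log_rec_unique _ hQ recL).
by rewrite /log_genfun /fps_add /= /fps_neglog1m big_geq ?addr0.
Qed.

(** * Lucas sequences as a solution of the recursion *)

(** With (x0, x1) = (0, 1) and (2, a) these are the two classical Lucas
    sequences U_n(a, b) and V_n(a, b). *)
Fixpoint lucas (A : nzRingType) (a b x0 x1 : A) (n : nat) : A :=
  if n is m.+1 then lucas a b x1 (a * x1 - b * x0) m else x0.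

Lemma lucasSS (A : nzRingType) (a b x0 x1 : A) n :
  lucas a b x0 x1 n.+2 = a * lucas a b x0 x1 n.+1 - b * lucas a b x0 x1 n.
Proof. by elim: n x0 x1 => [//|n IHn] x0 x1; rewrite [LHS]IHn. Qed.

Lemma nat_ind2 (T : nat -> Prop) :
  T 0%N -> T 1%N -> (forall n, T n -> T n.+1 -> T n.+2) -> forall n, T n.
Proof.
move=> T0 T1 TSS n; suff [//] : T n /\ T n.+1.
by elim: n => [//|n [Tn Tn1]]; split=> //; apply: TSS.
Qed.

(** The classical relation V_n = a U_n - 2 b U_(n-1), with U scaled by c. *)
Lemma lucasVE (A : comNzRingType) (a b c : A) n :
  c * lucas a b 2 a n.+1 =
    a * lucas a b 0 c n.+1 - b * lucas a b 0 c n *+ 2.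
Proof.
elim/nat_ind2: n => [||n IH0 IH1]; [rewrite /=; ring | rewrite /=; ring |].
rewrite (lucasSS a b 2 a n.+1) mulrBr !(mulrCA c) IH0 IH1.
rewrite (lucasSS a b 0 c n.+1) (lucasSS a b 0 c n); ring.
Qed.

(** The expansion of - log (1 - L z + g z^2) for L = a x + b: the factor
    1 - b z + g z^2 yields the constant terms, and v is
    a z / (1 - b z + g z^2). Both sides satisfy the same three-term recurrence,
    the right side because convolution with v inherits the recurrence of v. *)
Lemma lucas_log_rec (R : numFieldType) (a b g : R) :
  log_rec (lucas b g 0 a)
    (fun n => lucas (a *: 'X + b%:P) g%:P 2 (a *: 'X + b%:P) n
              - (lucas b g 2 b n)%:P).
Proof.
set v := lucas b g 0 a; set c := lucas b g 2 b; set L := a *: 'X + b%:P.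
set Q := fun n => _ - _.
have LE : L = a%:P * 'X + b%:P by rewrite /L mul_polyC.
elim/nat_ind2 => [||n IH0 IH1].
- by rewrite big_ord_recl big_ord0 /Q /v /= rmorph_nat subrr mul0r !addr0 mulr0.
- rewrite !big_ord_recl big_ord0 /Q /v /= rmorph_nat LE subrr !mulr0 mul0r !addr0 mulr1n.
  by ring.
have vSS i : v i.+2 = b * v i.+1 - g * v i by exact: lucasSS.
have QSS : Q n.+2 = b%:P * Q n.+1 - g%:P * Q n
                      + a%:P * 'X * (Q n.+1 + (c n.+1)%:P).
  rewrite /Q /c !lucasSS polyCB !polyCM {1}LE; ring.
have NSS : v n.+2 *+ n.+2 = b * (v n.+1 *+ n.+1) - g * (v n *+ n) + a * c n.+1.
  rewrite /c lucasVE -/v vSS; move: (v n.+1) (v n) => x y; ring.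
have sumSS : \sum_(i < n.+3) (v i)%:P * Q (n.+2 - i)%N =
    b%:P * (\sum_(i < n.+2) (v i)%:P * Q (n.+1 - i)%N)
    - g%:P * (\sum_(i < n.+1) (v i)%:P * Q (n - i)%N) + a%:P * Q n.+1.
  rewrite 2!big_ord_recl [X in b%:P * X]big_ord_recl /=.
  rewrite (_ : v 0%N = 0) // (_ : v 1%N = a) // subn1 /= !mul0r !add0r addrC.
  congr (_ + _); rewrite !mulr_sumr -sumrB; apply: eq_bigr => i _.
  rewrite /bump /= !add1n !subSS vSS polyCB !polyCM; ring.
rewrite QSS NSS sumSS {1}IH0 {1}IH1.
rewrite polyCD polyCB !polyCM; ring.
Qed.

(** Changing v first at degree m changes Q_m only through the term m v_m, and
    changes the coefficient of x^2 in Q_(m+1) through both v_1 Q_m and v_m Q_1,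
    whence the factor m + 1. The different factors m and m + 1 are what makes
    the change incompatible with a three-term recurrence. *)
Lemma log_rec_diff (R : numFieldType) (v w : nat -> R) (Q Qw : nat -> {poly R})
    (m : nat) :
  v 0%N = 0 -> w 0%N = 0 -> log_rec v Q -> log_rec w Qw -> (1 < m)%N ->
  (forall k, (k < m)%N -> v k = w k) ->
  [/\ forall n, (n < m)%N -> Q n = Qw n,
      Q m - Qw m = ((v m - w m) *+ m)%:P * 'X &
      exists h, Q m.+1 - Qw m.+1 =
        h%:P * 'X + ((v m - w m) * v 1%N *+ m.+1)%:P * 'X ^+ 2].
Proof.
move=> v0 w0 hQ hQw m1 vw.
pose E n := Q n - Qw n.
have Q0 : Q 0%N = 0.
  by rewrite hQ mulr0n big_ord_recl big_ord0 v0 mul0r !addr0 mulr0.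
have Q1 : Q 1%N = (v 1%N)%:P * 'X.
  by rewrite hQ !big_ord_recl big_ord0 v0 Q0 mul0r mulr0 !addr0 mulrC.
(* The difference of the convolutions is split so that one factor of each
   product is a difference. *)
have EE n : E n = 'X * (((v n - w n) *+ n)%:P +
    (\sum_(i < n.+1) (v i - w i)%:P * Q (n - i)%N
      + \sum_(i < n.+1) (w i)%:P * E (n - i)%N)).
  rewrite -big_split {1}/E hQ hQw -mulrBr mulrnBl polyCB opprD addrACA.
  rewrite -sumrB; congr (_ * (_ + _)); apply: eq_bigr => i _ /=.
  rewrite /E polyCB; ring.
have Elt n : (n < m)%N -> E n = 0.
  elim/ltn_ind: n => n IHn ltnm.
  rewrite EE vw // subrr mul0rn !big1 ?addr0 ?mulr0 // => -[i lti] _ /=.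
    case: i lti => [|i] lti; first by rewrite w0 mul0r.
    have lt' : (n - i.+1 < n)%N by rewrite ltn_subrL /=; case: n lti {IHn ltnm}.
    by rewrite IHn ?mulr0 // (ltn_trans lt').
  by rewrite vw ?subrr ?mul0r // (leq_trans lti).
have Em : E m = ((v m - w m) *+ m)%:P * 'X.
  rewrite EE [X in _ + (X + _)]big1 ?[X in _ + (_ + X)]big1 ?addr0.
  - by rewrite mulrC.
  - move=> [[|i] lti] _ /=; first by rewrite w0 mul0r.
    by rewrite Elt ?mulr0 // ltn_subrL /= (ltn_trans _ m1).
  - move=> [i lti] _ /=; move: lti; rewrite ltnS leq_eqVlt => /predU1P[->|lti].
      by rewrite subnn Q0 mulr0.
    by rewrite vw ?subrr ?mul0r.
split=> // [n ltnm|]; first by apply/eqP; rewrite -subr_eq0 -/(E n) Elt.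
exists ((v m.+1 - w m.+1) *+ m.+1); rewrite -/(E _) EE.
(* Only i = m survives in the first sum, and i = 1 in the second. *)
have ltm : (m < m.+2)%N by rewrite ltnS leqW.
rewrite (bigD1 (Ordinal ltm)) //= [X in _ + (_ + X + _)]big1; last first.
  move=> [i lti]; rewrite -val_eqE /= => nim.
  move: lti; rewrite ltnS leq_eqVlt => /predU1P[->|].
    by rewrite subnn Q0 mulr0.
  by rewrite ltnS leq_eqVlt (negPf nim) => /= lti; rewrite vw ?subrr ?mul0r.
rewrite (bigD1 (Ordinal (isT : (1 < m.+2)%N))) //= [X in _ + (_ + (_ + X))]big1.
  rewrite subSnn Q1 subSS subn0 Em !addr0 -(vw 1%N) //.
  move: (v m - w m) (v m.+1 - w m.+1) (w 1%N) => d e x.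
  rewrite !polyCMn polyCM; ring.
move=> [[|[|i]] lti] // _ /=; first by rewrite w0 mul0r.
rewrite subSS Elt ?mulr0 // ltn_subrL /= (ltn_trans _ m1) //.
Qed.

(** * Orthogonal polynomials for a positive functional *)

Section OrthogonalPolynomials.

Variables (R : numFieldType) (l : {scalar {poly R}}) (P : nat -> {poly R}).
Hypothesis sizeP : forall n, size (P n) = n.+1.
Hypothesis orthP : forall m n : nat, m != n -> l (P m * P n) = 0.
Hypothesis posl : forall p : {poly R}, p != 0 -> 0 < l (p * p).

Let lZ c p : l (c *: p) = c * l p. Proof. exact: linearZ. Qed.

(** The P_k with k < n span the polynomials of degree less than n. *)
Lemma orthogonal_lower n (q : {poly R}) : (size q <= n)%N -> l (P n * q) = 0.
Proof.
suff H k (p : {poly R}) : (k <= n)%N -> (size p <= k)%N -> l (P n * p) = 0 by exact: H.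
elim: k p => [|k IHk] p lekn.
  by rewrite leqn0 size_poly_eq0 => /eqP ->; rewrite mulr0 raddf0.
move=> szp.
pose c := p`_k / lead_coef (P k).
have Pk0 : lead_coef (P k) != 0 by rewrite lead_coef_eq0 -size_poly_eq0 sizeP.
rewrite -(subrK (c *: P k) p) mulrDr raddfD /= -scalerAr lZ.
rewrite orthP ?mulr0 ?addr0; last by rewrite neq_ltn lekn orbT.
apply: IHk; first exact: ltnW.
apply/leq_sizeP => j; rewrite leq_eqVlt => /predU1P[<-|ltkj].
  rewrite coefB coefZ; have -> : (P k)`_k = lead_coef (P k).
    by rewrite lead_coefE sizeP.
  by rewrite divfK ?subrr.
rewrite coefB coefZ !nth_default ?mulr0 ?subrr ?sizeP //.
exact: leq_trans szp ltkj.
Qed.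

(** S is orthogonal to P_n and P_(n+2) by its degree, and to L P_(n+1) because
    L S still has degree at most n; so it is orthogonal to itself. *)
Lemma recurrence_defect (L S : {poly R}) (g : R) n :
  (size L <= 2)%N -> (size S <= n)%N ->
  L * P n.+1 = P n.+2 + g *: P n + S -> S = 0.
Proof.
move=> szL szS e; apply/eqP/contraT => /posl.
suff -> : l (S * S) = 0 by rewrite ltxx.
rewrite {1}(_ : S = P n.+1 * L - P n.+2 - g *: P n); last first.
  by rewrite mulrC e [_ + S]addrC [P n.+2 + _]addrC addrA !addrK.
rewrite !mulrBl !raddfB /= -scalerAl lZ -mulrA.
rewrite !orthogonal_lower ?mulr0 ?subrr //.
  by rewrite (leq_trans szS) // leqW.
rewrite (leq_trans (size_polyMleq _ _)) //.
by move: (leq_add szL szS); case: (_ + _)%N.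
Qed.

(** Both recurrences evaluate the pairing of L P_(n+2) with P_(n+1), so g is the
    ratio of the squared norms of P_(n+2) and P_(n+1). *)
Lemma recurrence_pos (L : {poly R}) (g : R) n :
  L * P n.+2 = P n.+3 + g *: P n.+1 -> L * P n.+1 = P n.+2 + g *: P n -> 0 < g.
Proof.
move=> e2 e1.
have P0 k : P k != 0 by rewrite -size_poly_eq0 sizeP.
have : g * l (P n.+1 * P n.+1) = l (P n.+2 * P n.+2).
  transitivity (l (L * P n.+2 * P n.+1)).
    rewrite e2 mulrDl raddfD /= -scalerAl lZ (orthP (m := n.+3)) ?add0r //.
    by rewrite gtn_eqF.
  rewrite mulrAC e1 mulrDl raddfD /= -scalerAl lZ (orthP (m := n)).
    by rewrite mulr0 addr0.
  by rewrite ltn_eqF.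
by move=> e; rewrite -(pmulr_lgt0 _ (posl (P0 n.+1))) e posl.
Qed.

End OrthogonalPolynomials.

(** * The moment functional of a measure *)

Section Measure.
Variables (R : realType) (mu : {measure set (measurableTypeR R) -> \bar R}).
Hypothesis int_pow : forall n, mu.-integrable setT (fun x : R => (x ^+ n)%:E).

Lemma integrable_horner (p : {poly R}) :
  mu.-integrable setT (fun x : R => (p.[x])%:E).
Proof.
rewrite [X in mu.-integrable _ X](_ : _ = fun x : R =>
   (\sum_(i < size p) (p`_i)%:E * (x ^+ i)%:E)%E); last first.
  by apply/funext => x; rewrite horner_coef -sumEFin.
by apply: integrable_sum => //= i _; apply: integrableZl.
Qed.

Definition moment (p : {poly R}) : R := \int[mu]_x p.[x].

Lemma moment_scalar : scalar moment.
Proof.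
move=> c p q; rewrite /moment.
under eq_Rintegral do rewrite hornerD hornerZ.
rewrite RintegralD //=; first rewrite RintegralZl //.
- exact: integrable_horner.
- exact: (integrableZl measurableT c (integrable_horner p)).
- exact: integrable_horner.
Qed.

Lemma infinite_not_roots (A : set R) (p : {poly R}) :
  infinite_set A -> p != 0 -> exists2 x, A x & ~~ root p x.
Proof.
move=> /(infinite_set_fset (size p))[B BA szB] p0.
apply: contrapT => noroot; move: szB; rewrite leqNgt => /negP; apply.
apply: max_poly_roots => //; last exact: finmap.fset_uniq.
apply/allP => x xB; apply: contrapT => /negP px.
by apply: noroot; exists x => //; apply: BA.
Qed.

(** If p^2 had integral zero, the open set where p does not vanish would be
    null, so that every point of the infinite support would be a root of p. *)
Lemma moment_pos (p : {poly R}) :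
  infinite_set (mu_support mu) -> p != 0 -> 0 < moment (p * p).
Proof.
move=> inf p0; have [x xs px] := infinite_not_roots inf p0.
rewrite /moment lt_def; apply/andP; split; last first.
  by apply: Rintegral_ge0 => y _; rewrite hornerM -expr2 sqr_ge0.
apply/negP => /eqP m0.
pose U := [set y : R | p.[y] != 0]%classic.
have oU : open U.
  apply: (@open_comp _ _ (horner p) [set y : R | y != 0]%classic); last exact: open_neq.
  by move=> y _; exact: continuous_horner.
suff U0 : mu U = 0%E by have := xs U oU px; rewrite U0 ltxx.
have int0 : (\int[mu]_y `|((p * p).[y])%:E| = 0%:E)%E.
  rewrite -m0 /Rintegral fineK; last first.
    exact: integrable_fin_num (integrable_horner _).
  apply: eq_integral => y _.
  by rewrite gee0_abs // lee_fin hornerM -expr2 sqr_ge0.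
have /integrableP[mf _] := integrable_horner (p * p).
have /(_ int0) [N [mN N0 sN]] := (ae_eq_integral_abs mu measurableT mf).1.
apply/negligibleP; first exact: measurable_realfun.open_measurable.
exists N; split=> // y Uy; apply: sN => /= /(_ I) /eqP.
by rewrite eqe hornerM mulf_eq0 orbb => /eqP py; move: Uy; rewrite /U /= py eqxx.
Qed.

End Measure.

(** * Chebyshev polynomials *)

Lemma chebyshevT0 (R : realType) : chebyshevT R 0 = 1.
Proof.
by symmetry; apply: chebyshevT_unique => t; rewrite hornerC mul0r cos0.
Qed.

Lemma chebyshevT1 (R : realType) : chebyshevT R 1 = 'X.
Proof. by symmetry; apply: chebyshevT_unique => t; rewrite hornerX mul1r. Qed.

Lemma chebyshevTSS (R : realType) n :
  chebyshevT R n.+2 = 'X * chebyshevT R n.+1 *+ 2 - chebyshevT R n.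
Proof.
symmetry; apply: chebyshevT_unique => t.
rewrite hornerD hornerN hornerMn hornerM hornerX !chebyshevTP.
have -> : n%:R * t = n.+1%:R * t - t by rewrite -natr1; ring.
have -> : n.+2%:R * t = n.+1%:R * t + t by rewrite -(natr1 n.+1); ring.
rewrite !cosD cosN sinN; ring.
Qed.

(** Rescaling C_n by r^n turns C_(n+2) = L C_(n+1) - r^2 C_n into the Chebyshev
    recurrence in the variable L / (2 r); the factor 2 comes from C_0 = 2. *)
Lemma lucas_chebyshevT (R : realType) (s t r : R) n :
  let L := (2 * r * s) *: 'X + (2 * r * t)%:P in
  lucas L (r ^+ 2)%:P 2 L n = chebyshevT_affine (2 * r ^+ n) s t n.
Proof.
rewrite /chebyshevT_affine /=; elim/nat_ind2: n => [||n IH0 IH1].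
- by rewrite chebyshevT0 comp_polyC expr0 mulr1 alg_polyC rmorph_nat.
- rewrite chebyshevT1 comp_polyX -!mul_polyC !polyCM rmorph_nat /=; ring.
rewrite lucasSS IH0 IH1 chebyshevTSS mulr2n comp_polyB comp_polyD comp_polyM.
rewrite comp_polyX -!mul_polyC !exprS !(polyCM, polyCD) expr0 polyC1; ring.
Qed.

(** * Identification of the polynomials *)

Lemma quadratic_eq0 (R : comNzRingType) (a b c : R) :
  a%:P * 'X ^+ 2 + b%:P * 'X + c%:P = 0 -> [/\ a = 0, b = 0 & c = 0].
Proof.
by move/polyP => e; split; [have := e 2 | have := e 1 | have := e 0];
  rewrite !coefD !coefCM coefX coefXn coefC ?coef0 /=
          ?(mulr0, mulr1, addr0, add0r).
Qed.

Lemma size_quadratic (R : comNzRingType) (a b c : R) :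
  (size (a%:P * 'X ^+ 2 + b%:P * 'X + c%:P)%R <= 3)%N.
Proof.
apply/leq_sizeP => -[|[|[|j]]] // _.
by rewrite !coefD !coefCM coefX coefXn coefC ?coef0 /= !mulr0 !addr0.
Qed.

Lemma size_affine (R : nzRingType) (a b : R) :
  (size (a *: 'X + b%:P)%R <= 2)%N.
Proof.
apply/leq_sizeP => -[|[|j]] // _.
by rewrite coefD coefZ coefX coefC /= mulr0 addr0.
Qed.

(** The first three coefficients of v determine the candidate a, b, g;
    orthogonality then excludes every deviation from it, first in v and then
    in u. *)
Lemma log_genfun_lucas (R : numFieldType) (u v : nat -> R)
    (P : nat -> {poly R}) (l : {scalar {poly R}}) :
  has_log_genfun u v P ->
  (forall n, size (P n) = n.+1) ->
  (forall m n : nat, m != n -> l (P m * P n) = 0) ->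
  (forall p : {poly R}, p != 0 -> 0 < l (p * p)) ->
  exists a b g : R, [/\ a != 0, 0 < g &
    forall n, (0 < n)%N ->
      P n = lucas (a *: 'X + b%:P) g%:P 2 (a *: 'X + b%:P) n].
Proof.
move=> /has_log_genfunP[P0 recP] sizeP orthP posl.
set V := zseries 0 v in recP; set Q := zseries 0 _ in recP.
have PE n : P n.+1 = Q n.+1 + (u n.+1)%:P by rewrite /= subrK.
have Q0 : Q 0%N = 0 by [].
have a0 : V 1%N != 0.
  apply/eqP => a0; have := sizeP 1%N.
  rewrite PE recP !big_ord_recl big_ord0 a0 Q0 mul0rn !mul0r !addr0 mulr0 add0r.
  by rewrite size_polyC; case: (_ == _).
pose a := V 1%N; pose b := V 2%N / a; pose g := b ^+ 2 - V 3%N / a.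
pose L := a *: 'X + b%:P.
pose C := lucas L g%:P 2 L; pose w := lucas b g 0 a; pose c := lucas b g 2 b.
have recC : log_rec w (fun n => C n - (c n)%:P) by exact: lucas_log_rec.
have w0 : w 0%N = 0 by [].
have CSS n : C n.+2 = L * C n.+1 - g *: C n.
  by rewrite -mul_polyC; exact: lucasSS.
have szL : (size L <= 2)%N := size_affine a b.
pose D n := P n - C n.
have PSS n : L * P n.+1 =
    P n.+2 + g *: P n + (L * D n.+1 - D n.+2 - g *: D n).
  rewrite /D CSS -!mul_polyC; ring.
have defect n : (size (L * D n.+1 - D n.+2 - g *: D n)%R <= n)%N ->
    L * D n.+1 - D n.+2 - g *: D n = 0.
  by move=> szS; apply: (recurrence_defect sizeP orthP posl szL szS (PSS n)).
pose e n := u n - c n.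
have DE n : D n.+1 = Q n.+1 - (C n.+1 - (c n.+1)%:P) + (e n.+1)%:P.
  rewrite /D PE /e polyCB; ring.
have agree m : forall k, (k < m)%N -> V k = w k.
  elim: m => [//|m IHm] k; rewrite ltnS leq_eqVlt => /predU1P[->|]; last exact: IHm.
  case: m IHm => [|[|[|[|m]]]] IHm.
  - by [].
  - by [].
  - by rewrite /w /= mulr0 subr0 /b divfK.
  - have -> : w 3%N = b * (b * a) - g * a by rewrite /w /= mulr0 subr0.
    by rewrite /g mulrBl [V 3%N / a * a]divfK //; ring.
  have [Elt Em [h Em1]] := log_rec_diff (erefl : V 0%N = 0) w0 recP recC
    (isT : (1 < m.+4)%N) IHm.
  cbv beta in Elt, Em, Em1; set f := V m.+4 - w m.+4 in Em Em1.
  (* The coefficient of x^2 in the defect is - a f. *)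
  have := defect m.+3; rewrite !DE Em Em1 Elt // subrr add0r.
  rewrite (_ : _ - _ = (a * (f *+ m.+4) - f * a *+ m.+4.+1)%:P * 'X ^+ 2
    + (a * e m.+4 + b * (f *+ m.+4) - h)%:P * 'X
    + (b * e m.+4 - e m.+4.+1 - g * e m.+3)%:P); last first.
    rewrite /L -!mul_polyC !(polyCB, polyCD, polyCM, polyCMn); ring.
  have sz3 := leq_trans (size_quadratic _ _ _) (isT : (3 <= m.+3)%N).
  move=> /(_ (sz3 _ _ _ _)) /quadratic_eq0[f0 _ _].
  apply/eqP; rewrite -subr_eq0 -/f -oppr_eq0 -(mulIr_eq0 _ (mulIf a0)) -/a.
  by rewrite -[X in _ == X]f0; apply/eqP; ring.
have vw k : V k = w k by exact: agree (ltnSn k).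
have QE n : Q n = C n - (c n)%:P.
  apply: (log_rec_unique w0 _ recC) => k; rewrite -vw recP.
  by congr (_ * (_ + _)); apply: eq_bigr => i _; rewrite vw.
have {}DE n : D n.+1 = (e n.+1)%:P by rewrite DE QE subrr add0r.
have SE n : L * D n.+2 - D n.+3 - g *: D n.+1 =
    0%:P * 'X ^+ 2 + (a * e n.+2)%:P * 'X + (b * e n.+2 - e n.+3 - g * e n.+1)%:P.
  rewrite !DE /L -!mul_polyC !(polyCB, polyCM, polyC0); ring.
have S2 n : L * D n.+3 - D n.+4 - g *: D n.+2 = 0.
  apply: defect; apply: leq_trans (isT : (2 <= n.+2)%N).
  by rewrite SE polyC0 mul0r add0r mul_polyC size_affine.
(* Once v is known, the defect is affine with slope a e_(n+2), and it vanishes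
   as soon as its degree bound applies. *)
have e3 n : e n.+3 = 0.
  have := S2 n; rewrite SE => /quadratic_eq0[_ /eqP + _].
  by rewrite mulf_eq0 (negPf a0) => /eqP.
have rec3 n : L * P n.+3 = P n.+4 + g *: P n.+2 by rewrite PSS S2 addr0.
have g0 : 0 < g := recurrence_pos sizeP orthP posl (rec3 1%N) (rec3 0%N).
have e2 : e 2%N = 0.
  have := S2 0%N; rewrite SE !e3 => /quadratic_eq0[_ _ /eqP].
  by rewrite mulr0 subr0 sub0r oppr_eq0 mulf_eq0 gt_eqF // => /eqP.
have e1 : e 1%N = 0.
  have := defect 1%N; rewrite SE e2 e3 !(mulr0, polyC0, mul0r, add0r, oppr0).
  move=> /(_ (size_polyC_leq1 _)) /eqP.
  by rewrite polyC_eq0 oppr_eq0 mulf_eq0 gt_eqF // => /eqP.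
exists a, b, g; split=> // -[|n] // _; apply/eqP; rewrite -subr_eq0 -/(D _) DE.
by rewrite polyC_eq0; case: n => [|[|n]]; rewrite ?e1 ?e2 ?e3.
Qed.

Theorem proposition2 (R : realType) :
  (forall (u v : nat -> R) (P : nat -> {poly R}),
     has_log_genfun u v P -> orthogonal_family P ->
     exists (s t : R) (kappa : nat -> R),
       [/\ s != 0, forall n, kappa n != 0 &
           forall n, P n = chebyshevT_affine (kappa n) s t n])
  /\
  (forall s t : R, s != 0 ->
     exists kappa : nat -> R, (forall n, kappa n != 0) /\
       exists u v : nat -> R,
         has_log_genfun u v (fun n => chebyshevT_affine (kappa n) s t n)).
Proof.
have affine0 s t : chebyshevT_affine 1 s t 0 = 1 :> {poly R}.
  by rewrite /chebyshevT_affine chebyshevT0 comp_polyC scale1r.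
split=> [u v P gfP [sizeP [mu [inf int_pow orthP]]] | s t s0].
  pose l : {scalar {poly R}} :=
    HB.pack (moment mu) (GRing.isLinear.Build _ _ _ _ _ (moment_scalar int_pow)).
  have orthl (m n : nat) : m != n -> l (P m * P n) = 0.
    move=> mn; rewrite /= /moment /Rintegral.
    by under eq_integral do rewrite hornerM; rewrite orthP.
  have posl (p : {poly R}) : p != 0 -> 0 < l (p * p) by exact: moment_pos.
  have [a [b [g [a0 g0 PE]]]] := log_genfun_lucas gfP sizeP orthl posl.
  pose r := Num.sqrt g.
  have r0 : r != 0 by rewrite gt_eqF ?sqrtr_gt0.
  (* kappa_0 is 1 and not 2 because P_0 = 1 while C_0 = 2. *)
  exists (a / (2 * r)), (b / (2 * r)), (fun n => if n is 0 then 1 else 2 * r ^+ n).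
  have r20 : 2 * r != 0 by rewrite mulf_neq0 ?pnatr_eq0.
  split=> [||[|n]].
  - by rewrite mulf_neq0 ?invr_eq0.
  - by case=> [|n]; rewrite ?oner_eq0 // mulf_neq0 ?expf_neq0 ?pnatr_eq0.
  - by rewrite affine0; have [] := gfP.
  - by rewrite PE // -lucas_chebyshevT /= sqr_sqrtr ?ltW // ![2 * r * _]mulrC !divfK.
exists (fun n => if n is 0 then 1 else 2); split.
  by case=> [|n]; rewrite ?oner_eq0 ?pnatr_eq0.
exists (lucas (2 * t) 1 2 (2 * t)), (lucas (2 * t) 1 0 (2 * s)).
apply/has_log_genfunP; split; first exact: affine0.
have rec := lucas_log_rec (2 * s) (2 * t) 1.
set V := zseries 0 (lucas _ _ _ _); set Q := zseries 0 _.
have -> : V = lucas (2 * t) 1 0 (2 * s) by apply/funext; case.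
suff -> : Q = fun n => lucas ((2 * s) *: 'X + (2 * t)%:P) 1%:P 2
    ((2 * s) *: 'X + (2 * t)%:P) n - (lucas (2 * t) 1 2 (2 * t) n)%:P by [].
apply/funext => -[|n]; first by rewrite /= rmorph_nat subrr.
have := lucas_chebyshevT s t 1 n.+1.
by rewrite /Q /zseries mulr1 !expr1n mulr1 => ->.
Qed.
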